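(* Let $G$ be a finite group. Then $G\cong P(U)$ for some finite angle set $U$ with $0\in U$ containing at least 3 angles (considered modulo $\pi$) if and only if $G$ is isomorphic to one of the following groups: (1) $\mathbb{Z}/2\mathbb{Z}\times\mathbb{Z}/2\mathbb{Z}$; (2) $\mathbb{Z}/n\mathbb{Z}$ for an even positive integer $n$; (3) $D_n$ for an even positive integer $n$.
   Context: $D_n$ denotes the dihedral group of order $2n$ (the symmetry group of a regular $n$-gon; for $n=2$, $D_2=\mathbb{Z}/2\mathbb{Z}\times\mathbb{Z}/2\mathbb{Z}$). Identify $\mathbb{C}$ with $\mathbb{R}^2$. For $p\in\mathbb{C}$ and an angle $\alpha$, let $L_{p,\alpha}=\{p+r(\cos\alpha+i\sin\alpha): r\in\mathbb{R}\}$. Angles in $U$ are considered modulo $\pi$. For $p,q\in\mathbb{C}$ and distinct angles $\alpha\ne\beta$ (mod $\pi$), $[\![p,q]\!]_{\alpha,\beta}$ denotes the intersection point of $L_{p,\alpha}$ and $L_{q,\beta}$. For a finite set of angles $U$ containing $0$, put $M_1(U)=\{[\![0,1]\!]_{\alpha,\beta}:\alpha,\beta\in U,\ \alpha\neq\beta\}$ and, for $k>1$, $M_k(U)=\{[\![p,q]\!]_{\alpha,\beta}: p,q\in M_{k-1}(U),\ \alpha,\beta\in U,\ \alpha\ne\beta\}$. The origami set is $M(U)=\bigcup_k M_k(U)$. The point group $P(U)$ is the group of those rotations about the origin and reflections across lines through the origin under which both $U$ and $M(U)$ are closed. Rotation by $\theta$ sends an angle $\alpha$ to $\alpha+\theta$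 (mod $\pi$); reflection across the angle $\theta$, i.e. across the line through the origin at angle $\theta$, sends $\alpha$ to $2\theta-\alpha$ (mod $\pi$). *)

(* Defs.v *)
From HB Require Import structures.
From mathcomp Require Import all_boot all_order all_algebra all_fingroup.
From mathcomp Require Import all_solvable.
From mathcomp Require Import all_classical all_reals all_analysis.
From mathcomp Require Import complex.

Set Implicit Arguments.
Unset Strict Implicit.
Unset Printing Implicit Defensive.

Import Order.TTheory GRing.Theory Num.Theory.

Local Open Scope classical_set_scope.
Local Open Scope ring_scope.
Local Open Scope complex_scope.

(* Angles are real numbers considered modulo pi, and a set of angles is given *)
(* by a set of real representatives: two representatives of the same angle    *)
(* are allowed, so distinctness and membership of angles always go through    *)
(* eq_mod_pi.                                                                 *)
Definition eq_mod_pi (R : realType) (a b : R) : Prop :=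
  exists k : int, a - b = k%:~R * pi.

Definition has_angle (R : realType) (U : set R) (a : R) : Prop :=
  exists2 b : R, U b & eq_mod_pi a b.

Definition at_least_three_angles (R : realType) (U : set R) : Prop :=
  exists a b c : R,
    [/\ U a, U b & U c] /\
    [/\ ~ eq_mod_pi a b, ~ eq_mod_pi a c & ~ eq_mod_pi b c].

Definition cis (R : realType) (a : R) : R[i] := cos a +i* sin a.

Definition aline (R : realType) (p : R[i]) (a : R) : set R[i] :=
  [set p + r%:C * cis a | r in [set: R]].

(* z is the intersection point of the lines L_{p,a} and L_{q,b}. *)
Definition is_inter (R : realType) (p q : R[i]) (a b : R) (z : R[i]) : Prop :=
  aline p a `&` aline q b = [set z].

(* Indices are shifted by one: origami_step U k is M_{k+1}(U). *)
Fixpoint origami_step (R : realType) (U : set R) (k : nat) : set R[i] :=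
  match k with
  | 0%N => [set z | exists a b : R,
             [/\ U a, U b, ~ eq_mod_pi a b & is_inter 0 1 a b z]]
  | k'.+1 => [set z | exists (p q : R[i]) (a b : R),
             [/\ origami_step U k' p, origami_step U k' q &
             [/\ U a, U b, ~ eq_mod_pi a b & is_inter p q a b z]]]
  end.

Definition origami (R : realType) (U : set R) : set R[i] :=
  \bigcup_k origami_step U k.

Definition rotation (R : realType) (t : R) (z : R[i]) : R[i] := cis t * z.

Definition reflection (R : realType) (t : R) (z : R[i]) : R[i] :=
  cis (2 * t) * z^*.

(* Elements of the point group are maps of the plane; the group law is        *)
(* composition. The rotation by pi fixes every angle modulo pi but is not the *)
(* identity map.                                                              *)
Definition point_group (R : realType) (U : set R) : set (R[i] -> R[i]) :=
  [set g | exists t : R,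
     [/\ g = rotation t,
         forall a, U a -> has_angle U (a + t) &
         g @` origami U `<=` origami U]
   \/
     [/\ g = reflection t,
         forall a, U a -> has_angle U (2 * t - a) &
         g @` origami U `<=` origami U]].

Definition isog_maps (gT : finGroupType) (G : {group gT}) (T : Type)
    (P : set (T -> T)) : Prop :=
  exists2 f : gT -> (T -> T),
    set_bij [set` G] P f & {in G &, {morph f : x y / (x * y)%g >-> x \o y}}.

(* The dihedral group D_n of order 2n, n >= 2; the library's 'D_m is indexed  *)
(* by its order m.                                                            *)
Definition dihedral (n : nat) : {group dihedral_gtype (2 * n)} :=
  [set: dihedral_gtype (2 * n)]%G.

(* Main.v *)
(* A linear isometry g carries the origami construction from 0, 1 to the one  *)
(* from 0, g 1, so it preserves M(U) as soon as it preserves U and g 1 lies   *)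
(* in M(U). Three angles always give -1 in M(U), so the rotation by pi is in  *)
(* P(U): the rotations form a cyclic group of even order n, and if there is a *)
(* reflection s then s and s r, with r a generating rotation, are involutions *)
(* generating D_n. Conversely, for n = 2 m, take for U all multiples of pi / n *)
(* and one or two further cosets of the multiples of 2 pi / n, chosen to rule *)
(* out every other rotation and, in the cyclic case, every reflection; M(U)   *)
(* contains the n-th roots of unity because [[0, 1]]_{2 s, s} = - cis (2 s).  *)
Require Import Defs.
From mathcomp Require Import all_boot all_order all_algebra all_fingroup.
From mathcomp Require Import all_solvable.
From mathcomp Require Import all_classical all_reals all_analysis.
From mathcomp Require Import complex.
From mathcomp Require Import ring lra zify.

Set Implicit Arguments.
Unset Strict Implicit.
Unset Printing Implicit Defensive.

Import Order.TTheory GRing.Theory Num.Theory.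

Local Open Scope classical_set_scope.
Local Open Scope ring_scope.
Local Open Scope complex_scope.

(** Forward direction: an element of P(U) is z -> c z or z -> c conj z with c conj c = 1, and
    [origamiN1] yields -1 in M(U), so z -> - z is in P(U) ([point_group_pi]). By
    [finite_plane_group], a finite group of such maps containing z -> - z is cyclic of even order n
    or dihedral of order 2 n with n even. Converse: for the angle set [grid R m d],
    [point_group_grid] computes P(U) exactly: the maps z -> zeta^i z, and also z -> zeta^i conj z
    when [d] holds, where zeta is a primitive root of unity of order 2 m. Preserving the angles
    allows no more ([grid_rotation], [grid_reflection]). All of these maps do occur, because the
    powers of zeta lie in M(U) ([origami_grid]) and an isometry fixing 0 preserves M(U) once it
    preserves U and sends 1 into M(U) ([origami_homo]). [Zp_isog_maps] and [dihedral_isog_maps]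
    identify the resulting groups; the Klein four-group is D_2. *)

(** * Unit complex numbers and angles modulo pi *)

Lemma cisD (R : realType) (a b : R) : cis (a + b) = cis a * cis b.
Proof.
by rewrite /cis cosD sinD; congr (_ +i* _); rewrite addrC (mulrC (sin a)) mulrC.
Qed.

Lemma cis0 (R : realType) : cis (0 : R) = 1.
Proof. by rewrite /cis cos0 sin0. Qed.

Lemma cis_pi (R : realType) : cis (pi : R) = -1.
Proof. by rewrite /cis cospi sinpi; apply/eqP; rewrite eq_complex /= oppr0 !eqxx. Qed.

Lemma cisMn (R : realType) (a : R) n : cis (n%:R * a) = cis a ^+ n.
Proof.
elim: n => [|n IHn]; first by rewrite mul0r cis0 expr0.
by rewrite -natr1 mulrDl mul1r cisD IHn exprSr.
Qed.

Lemma conj_cis (R : realType) (a : R) : Num.conj (cis a) = cis (- a).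
Proof. by rewrite /cis cosN sinN; exact: erefl. Qed.

Lemma cis_conjM (R : realType) (a : R) : cis a * Num.conj (cis a) = 1.
Proof. by rewrite conj_cis -cisD subrr cis0. Qed.

Lemma cis_int_pi (R : realType) (k : int) :
  cis (k%:~R * pi : R) = 1 \/ cis (k%:~R * pi : R) = -1.
Proof.
have cis_nat n : cis (n%:R * pi : R) = 1 \/ cis (n%:R * pi : R) = -1.
  by rewrite cisMn cis_pi -signr_odd; case: (odd n); [right|left].
case: k => n; first exact: cis_nat.
rewrite NegzE mulrNz mulNr -conj_cis.
by case: (cis_nat n.+1) => ->; [left|right]; rewrite ?rmorphN rmorph1.
Qed.

Lemma sin_eq0_mod_pi (R : realType) (x : R) :
  sin x = 0 <-> exists k : int, x = k%:~R * pi.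
Proof.
split=> [sx0|[k ->]]; last first.
  by case: (@cis_int_pi R k) => /eqP; rewrite eq_complex /= ?oppr0 => /andP[_ /eqP].
(* The remainder y lies in [0, pi) and sin y = 0; as sin is positive on (0, pi), y = 0. *)
exists (Num.floor (x / pi)); set k := Num.floor _.
have pi0 := pi_gt0 R.
apply/eqP; rewrite -subr_eq0; set y := (X in X == 0).
have sy0 : sin y = 0.
  have: cis y * cis (k%:~R * pi) = cis x by rewrite -cisD subrK.
  case: (@cis_int_pi R k) => -> /eqP; rewrite eq_complex ?mulrN mulr1 /= sx0.
    by case/andP=> _ /eqP.
  by rewrite oppr_eq0 => /andP[_ /eqP].
have /andP[y_ge0 y_ltpi] : 0 <= y < pi.
  have /andP[le_k lt_k] := Num.Theory.real_floor_itv (num_real (x / pi)).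
  move: le_k lt_k; rewrite -/k ler_pdivlMr // ltr_pdivrMr // intrD /y; lra.
rewrite eq_le y_ge0 andbT leNgt; apply/negP => y_gt0.
by have := @sin_gt0_pi R y; rewrite y_gt0 y_ltpi sy0 ltxx => /(_ isT).
Qed.

(** Up to sign, sin (a - b) is the determinant of the directions [cis a] and [cis b]. *)
Lemma eq_mod_pi_sin (R : realType) (a b : R) : eq_mod_pi a b <-> sin (a - b) = 0.
Proof. by rewrite sin_eq0_mod_pi. Qed.

(** * Lines and their intersections *)

Lemma alineP (R : realType) (p z : R[i]) (a : R) :
  aline p a z <-> exists r : R, z = p + r%:C * cis a.
Proof. by split=> [[r _ <-]|[r ->]]; exists r. Qed.

Lemma aline_eq_mod_pi (R : realType) (p z : R[i]) (a b : R) :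
  eq_mod_pi b a -> aline p a z -> aline p b z.
Proof.
move=> [k bak] /alineP[r ->]; apply/alineP.
have -> : b = k%:~R * pi + a by rewrite -bak subrK.
rewrite cisD; case: (cis_int_pi R k) => ->; first by exists r; rewrite mul1r.
by exists (- r); rewrite mulN1r mulrN rmorphN mulNr opprK.
Qed.

(** If w and z are common points, w - z is a multiple of both directions, which the nonzero
    determinant sin (a - b) forces to vanish. *)
Lemma is_interP (R : realType) (p q z : R[i]) (a b : R) :
  ~ eq_mod_pi a b -> is_inter p q a b z <-> aline p a z /\ aline q b z.
Proof.
rewrite eq_mod_pi_sin => /eqP sab; rewrite /is_inter; split=> [pq|[pz qz]].
  by have [] : (aline p a `&` aline q b) z by rewrite pq.
apply/seteqP; split=> [w [/alineP[r wr] /alineP[s ws]]|w -> //] /=.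
move: pz qz => /alineP[r' zr'] /alineP[s' zs'].
suff rr' : r = r' by rewrite wr zr' rr'.
have rs : (r - r')%:C * cis a = (s - s')%:C * cis b.
  rewrite !rmorphB !mulrBl.
  have -> : r%:C * cis a = w - p by rewrite wr addrC addKr.
  have -> : r'%:C * cis a = z - p by rewrite zr' addrC addKr.
  have -> : s%:C * cis b = w - q by rewrite ws addrC addKr.
  have -> : s'%:C * cis b = z - q by rewrite zs' addrC addKr.
  by rewrite !opprB !addrA !subrK.
have /= Er := congr1 (@complex.Re R) rs; have /= Ei := congr1 (@complex.Im R) rs.
apply/eqP; rewrite -subr_eq0 -(mulIr_eq0 _ (mulIf sab)) sinB.
rewrite !mul0r !subr0 !addr0 in Er Ei.
have -> : (r - r') * (sin a * cos b - cos a * sin b) =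
  (r - r') * sin a * cos b - (r - r') * cos a * sin b by ring.
by rewrite Er Ei; apply/eqP; ring.
Qed.

(** * Closure properties of M(U) *)

(** A point is the intersection of two lines through itself. *)
Lemma origami_stepS (R : realType) (U : set R) k z :
  at_least_three_angles U -> origami_step U k z -> origami_step U k.+1 z.
Proof.
move=> [a [b [_ [[Ua Ub _] [nab _ _]]]]] Uz; exists z, z, a, b; split=> //; split=> //.
apply/is_interP => //.
by split; apply/alineP; exists 0; rewrite mul0r addr0.
Qed.

Lemma origami_step_leq (R : realType) (U : set R) k l z :
  at_least_three_angles U -> (k <= l)%N -> origami_step U k z -> origami_step U l z.
Proof.
move=> U3 /subnK <- Uz; elim: (l - k)%N => // m IHm.
by rewrite addSn; apply: origami_stepS.
Qed.

Lemma has_angle_self (R : realType) (U : set R) a : U a -> has_angle U a.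
Proof. by exists a => //; exists 0; rewrite subrr mul0r. Qed.

Lemma eq_mod_pi_sym (R : realType) (a b : R) : eq_mod_pi a b -> eq_mod_pi b a.
Proof. by move=> [k kab]; exists (- k); rewrite -opprB kab mulrNz mulNr. Qed.

Lemma eq_mod_pi_trans (R : realType) (a b c : R) :
  eq_mod_pi a b -> eq_mod_pi b c -> eq_mod_pi a c.
Proof.
move=> [k kab] [l lbc]; exists (k + l).
by rewrite intrD mulrDl -kab -lbc addrA subrK.
Qed.

Lemma has_angle_representatives (R : realType) (U : set R) (a b : R) :
  has_angle U a -> has_angle U b -> ~ eq_mod_pi a b ->
  exists a' b', [/\ U a', U b', ~ eq_mod_pi a' b' & eq_mod_pi a' a /\ eq_mod_pi b' b].
Proof.
move=> [a' Ua' aa'] [b' Ub' bb'] nab; exists a', b'; split=> //.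
  move=> ab'; apply: nab; apply: eq_mod_pi_trans aa' _.
  by apply: eq_mod_pi_trans ab' _; apply: eq_mod_pi_sym.
by split; apply: eq_mod_pi_sym.
Qed.

(** Closure of M(U) under intersections, free of stages and of the choice of representatives: [p]
    and [q] are first raised to a common stage. *)
Lemma origami_inter (R : realType) (U : set R) (p q z : R[i]) (a b : R) :
  at_least_three_angles U -> origami U p -> origami U q ->
  has_angle U a -> has_angle U b -> ~ eq_mod_pi a b ->
  aline p a z -> aline q b z -> origami U z.
Proof.
move=> U3 [k _ Mp] [l _ Mq] Ua Ub nab pz qz.
have [a' [b' [Ua' Ub' nab' [aa' bb']]]] := has_angle_representatives Ua Ub nab.
exists (maxn k l).+1 => //; exists p, q, a', b'; split=> //.
- exact: origami_step_leq (leq_maxl _ _) Mp.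
- exact: origami_step_leq (leq_maxr _ _) Mq.
split=> //; apply/is_interP => //.
by split; [exact: aline_eq_mod_pi pz | exact: aline_eq_mod_pi qz].
Qed.

Lemma origami_inter01 (R : realType) (U : set R) (z : R[i]) (a b : R) :
  has_angle U a -> has_angle U b -> ~ eq_mod_pi a b ->
  aline 0 a z -> aline 1 b z -> origami U z.
Proof.
move=> Ua Ub nab pz qz.
have [a' [b' [Ua' Ub' nab' [aa' bb']]]] := has_angle_representatives Ua Ub nab.
exists 0%N => //; exists a', b'; split=> //; apply/is_interP => //.
by split; [exact: aline_eq_mod_pi pz | exact: aline_eq_mod_pi qz].
Qed.

(** At most one of three distinct angles is 0 modulo pi. *)
Lemma nonzero_angles (R : realType) (U : set R) :
  at_least_three_angles U -> exists a b,
  [/\ U a, U b, ~ eq_mod_pi a 0, ~ eq_mod_pi b 0 & ~ eq_mod_pi a b].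
Proof.
move=> [a [b [c [[Ua Ub Uc] [nab nac nbc]]]]].
have no2 x y : ~ eq_mod_pi x y -> eq_mod_pi x 0 -> ~ eq_mod_pi y 0.
  by move=> nxy x0 y0; apply: nxy; apply: eq_mod_pi_trans x0 _; apply: eq_mod_pi_sym.
have [a0|na0] := pselect (eq_mod_pi a 0).
  by exists b, c; split=> //; [exact: no2 nab a0 | exact: no2 nac a0].
have [b0|nb0] := pselect (eq_mod_pi b 0); last by exists a, b.
by exists a, c; split=> //; exact: no2 nbc b0.
Qed.

Lemma aline_refl (R : realType) (p : R[i]) (a : R) : aline p a p.
Proof. by apply/alineP; exists 0; rewrite mul0r addr0. Qed.

Lemma aline0P (R : realType) (p z : R[i]) :
  aline p 0 z <-> exists r : R, z = p + r%:C.
Proof.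
by rewrite alineP; split=> -[r ->]; exists r; rewrite cis0 mulr1.
Qed.

Lemma aline_sym (R : realType) (p z : R[i]) (a : R) : aline p a z -> aline z a p.
Proof.
by move=> /alineP[r ->]; apply/alineP; exists (- r); rewrite rmorphN mulNr addrK.
Qed.

Lemma aline_translate (R : realType) (p z v : R[i]) (a : R) :
  aline p a z -> aline (p + v) a (z + v).
Proof. by move=> /alineP[r ->]; apply/alineP; exists r; rewrite addrAC. Qed.

Lemma origami0 (R : realType) (U : set R) :
  U 0 -> at_least_three_angles U -> origami U 0.
Proof.
move=> U0 /nonzero_angles[a [_ [Ua _ na0 _ _]]].
apply: (origami_inter01 (has_angle_self Ua) (has_angle_self U0) na0).
  exact: aline_refl.
by apply/aline0P; exists (-1); rewrite rmorphN rmorph1 subrr.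
Qed.

(* With t = [[0, 1]]_{a, b}, the translate t - 1 is [[t, 0]]_{0, b}, and -1 is *)
(* [[0, t - 1]]_{0, a}.                                                       *)
Lemma origamiN1 (R : realType) (U : set R) :
  U 0 -> at_least_three_angles U -> origami U (-1).
Proof.
move=> U0 U3; have [a [b [Ua Ub na0 nb0 nab]]] := nonzero_angles U3.
have n0a : ~ eq_mod_pi 0 a by move=> a0; apply: na0; apply: eq_mod_pi_sym.
have n0b : ~ eq_mod_pi 0 b by move=> b0; apply: nb0; apply: eq_mod_pi_sym.
have [/has_angle_self hU0 /has_angle_self hUa /has_angle_self hUb] := And3 U0 Ua Ub.
have M0 := origami0 U0 U3.
have sba0 : sin (b - a) != 0.
  by apply/eqP => s0; apply: nab; apply: eq_mod_pi_sym; apply/eq_mod_pi_sin.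
(* Law of sines in the triangle 0, 1, t. *)
pose r := sin b / sin (b - a); pose s := sin a / sin (b - a).
have tE : r%:C * cis a = 1 + s%:C * cis b.
  apply/eqP; rewrite eq_complex /r /s /=; apply/andP; split; apply/eqP.
    by rewrite sinB in sba0 *; field.
  by rewrite !mul0r !addr0 add0r; ring.
set t := r%:C * cis a in tE.
have at_ : aline 0 a t by apply/alineP; exists r; rewrite add0r.
have bt : aline 1 b t by apply/alineP; exists s.
have Mt : origami U t := origami_inter01 hUa hUb nab at_ bt.
have Mt1 : origami U (t - 1).
  apply: (origami_inter U3 Mt M0 hU0 hUb n0b).
    by apply/aline0P; exists (-1); rewrite rmorphN rmorph1.
  by rewrite -(subrr 1); exact: aline_translate.
apply: (origami_inter U3 M0 Mt1 hU0 hUa n0a).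
  by apply/aline0P; exists (-1); rewrite rmorphN rmorph1 add0r.
by rewrite -[X in aline _ _ X]add0r; apply/aline_sym/aline_translate.
Qed.

(** * Isometries preserving M(U) *)

(** Such a [g] carries [[p, q]]_{a, b} to [[g p, g q]]_{h a, h b}, so induction on the stage reduces
    to the images of 0 and 1. Injectivity of [h] modulo pi keeps the two angles distinct. *)
Lemma origami_homo (R : realType) (U : set R) (g : R[i] -> R[i]) (h : R -> R) :
  at_least_three_angles U ->
  (forall p z a, aline p a z -> aline (g p) (h a) (g z)) ->
  (forall a, U a -> has_angle U (h a)) ->
  (forall a b, eq_mod_pi (h a) (h b) -> eq_mod_pi a b) ->
  origami U (g 0) -> origami U (g 1) -> g @` origami U `<=` origami U.
Proof.
move=> U3 gline hU hinj Mg0 Mg1 _ [z [k _ Mz] <-]; elim: k z Mz => [|k IHk] z /=.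
  move=> [a [b [Ua Ub nab /(is_interP 0 1 z nab)[az bz]]]].
  apply: (origami_inter U3 Mg0 Mg1 (hU _ Ua) (hU _ Ub)) (gline _ _ _ az) (gline _ _ _ bz).
  by move=> /hinj.
move=> [p [q [a [b [Mp Mq [Ua Ub nab /(is_interP p q z nab)[az bz]]]]]]].
apply: (origami_inter U3 (IHk _ Mp) (IHk _ Mq) (hU _ Ua) (hU _ Ub))
  (gline _ _ _ az) (gline _ _ _ bz).
by move=> /hinj.
Qed.

Lemma point_group_rotation (R : realType) (U : set R) (t : R) :
  U 0 -> at_least_three_angles U -> (forall a, U a -> has_angle U (a + t)) ->
  origami U (cis t) -> point_group U (rotation t).
Proof.
move=> U0 U3 Ut Mt; exists t; left; split=> //.
apply: (origami_homo U3 _ Ut).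
- move=> p z a /alineP[r ->]; apply/alineP; exists r.
  by rewrite /rotation mulrDr addrC cisD; ring.
- by move=> a b [k abk]; exists k; rewrite -abk; ring.
- by rewrite /rotation mulr0; exact: origami0.
- by rewrite /rotation mulr1.
Qed.

Lemma point_group_reflection (R : realType) (U : set R) (t : R) :
  U 0 -> at_least_three_angles U -> (forall a, U a -> has_angle U (2 * t - a)) ->
  origami U (cis (2 * t)) -> point_group U (reflection t).
Proof.
move=> U0 U3 Ut Mt; exists t; right; split=> //.
apply: (origami_homo U3 _ Ut).
- move=> p z a /alineP[r ->]; apply/alineP; exists r.
  rewrite /reflection rmorphD rmorphM mulrDr /= conj_cis cisD.
  have -> : (Num.conj r%:C : R[i]) = r%:C by exact: conjc_real.
  by ring.
- by move=> a b [k abk]; exists (- k); rewrite mulrNz mulNr -abk; ring.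
- by rewrite /reflection rmorph0 mulr0; exact: origami0.
- by rewrite /reflection rmorph1 mulr1.
Qed.

(** * Finite groups of plane isometries *)

(** For [c] of modulus 1, a common form for rotations ([b] false) and reflections ([b] true). *)
Definition plane_isometry (R : realType) (c : R[i]) (b : bool) (z : R[i]) : R[i] :=
  c * (if b then Num.conj z else z).

Lemma plane_isometry_comp (R : realType) (c d : R[i]) (b e : bool) :
  plane_isometry c b \o plane_isometry d e =
  plane_isometry (c * if b then Num.conj d else d) (b (+) e).
Proof.
by apply/funext => z; case: b e => [] []; rewrite /plane_isometry /= ?rmorphM /= ?conjCK mulrA.
Qed.

(** The value at 1 gives [c]; the value at i then gives [b], since conj i = - i. *)
Lemma plane_isometry_inj (R : realType) (c d : R[i]) (b e : bool) : c != 0 ->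
  plane_isometry c b = plane_isometry d e -> c = d /\ b = e.
Proof.
move=> c0 /[dup] /(congr1 (@^~ 1)) + /(congr1 (@^~ 'i%C)).
rewrite /plane_isometry !(fun_if, if_arg) rmorph1 !if_same !mulr1 => <-.
have ciN : c * 'i%C <> c * Num.conj 'i%C.
  move=> /(mulfI c0)/eqP; rewrite eq_complex /= eqxx /= -subr_eq0 opprK.
  by apply/negP; rewrite -mulr2n pnatr_eq0.
by case: b e => [] [] /= E; split=> //; case: ciN.
Qed.

(** [w] and [Phi] read the same words in the group and as maps of the plane. If they identify the
    same words and multiply them alike, sending x to [Phi] of any word for x is an isomorphism. *)
Lemma isog_maps_words (gT : finGroupType) (G : {group gT}) (T I : Type)
    (P : set (T -> T)) (D : set I) (w : I -> gT) (Phi : I -> T -> T) :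
  w @` D = [set` G] -> Phi @` D = P ->
  (forall u v, D u -> D v -> w u = w v <-> Phi u = Phi v) ->
  (forall u v, D u -> D v -> exists t,
     [/\ D t, (w u * w v)%g = w t & Phi u \o Phi v = Phi t]) ->
  isog_maps G P.
Proof.
move=> wG PhiP wPhi wM.
have /choice[u uP] : forall x, exists u, x \in G -> D u /\ w u = x.
  move=> x; have [|xG] := boolP (x \in G); last first.
    have : [set` G] 1%g by exact: group1.
    by rewrite -wG => -[u _ _]; exists u.
  by move=> xG; have : [set` G] x by []; rewrite -wG => -[u]; exists u.
exists (Phi \o u); last first.
  move=> x y xG yG /=; have [Dx wx] := uP x xG; have [Dy wy] := uP y yG.
  have [Dxy wxy] := uP _ (groupM xG yG).
  have [t [Dt wt ->]] := wM _ _ Dx Dy.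
  by apply/wPhi => //; rewrite wxy -wt wx wy.
split=> [x xG|x y /set_mem xG /set_mem yG /=|g]; rewrite -?PhiP.
- by exists (u x) => //; have [] := uP x xG.
- have [Dx wx] := uP x xG; have [Dy wy] := uP y yG.
  by move/wPhi => /(_ Dx Dy); rewrite wx wy.
- move=> [v Dv <-]; have wvG : w v \in G.
    by have : (w @` D) (w v) by [exists v]; rewrite wG.
  by exists (w v) => //=; have [Dw ww] := uP _ wvG; apply/wPhi.
Qed.

Lemma cyclic_isog_Zp (gT : finGroupType) (G : {group gT}) :
  cyclic G -> (G \isog Zp #|G|)%g.
Proof. by case/cyclicP=> x ->; rewrite isog_sym; exact: Zp_isog. Qed.

(** The rotations form a cyclic subgroup K containing the involution z -> - z. Either G = K, or a
    reflection s and s r, with r generating K, are distinct involutions generating G. *)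
Lemma finite_plane_group (R : realType) (gT : finGroupType) (G : {group gT})
    (f : gT -> R[i] -> R[i]) :
  {in G &, injective f} -> {in G &, {morph f : x y / (x * y)%g >-> x \o y}} ->
  {in G, forall x, exists c b, c * Num.conj c = 1 /\ f x = plane_isometry c b} ->
  (exists2 x, x \in G & f x = plane_isometry (-1) false) ->
  (exists n : nat, [/\ (0 < n)%N, ~~ odd n & (G \isog Zp n)%g]) \/
  (exists n : nat, [/\ (0 < n)%N, ~~ odd n & (G \isog dihedral n)%g]).
Proof.
move=> finj fM fiso [h hG fh].
have /choice[c /choice[b cb]] : forall x, exists c, exists b,
  x \in G -> c * Num.conj c = 1 /\ f x = plane_isometry c b.
  move=> x; case: (boolP (x \in G)) => [xG|]; last by exists 0, false.
  by have [c [b cb]] := fiso x xG; exists c, b.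
have cn0 x : x \in G -> c x != 0.
  move=> /cb[+ _]; apply: contra_eq_neq => ->; rewrite mul0r eq_sym; exact: oner_neq0.
have cbP x d e : x \in G -> f x = plane_isometry d e -> c x = d /\ b x = e.
  by move=> xG; rewrite (cb x xG).2; apply: plane_isometry_inj; exact: cn0.
have cbM x y : x \in G -> y \in G ->
    c (x * y)%g = c x * (if b x then Num.conj (c y) else c y) /\ b (x * y)%g = b x (+) b y.
  move=> xG yG; apply: cbP; first exact: groupM.
  by rewrite fM // (cb x xG).2 (cb y yG).2 plane_isometry_comp.
have inj x y : x \in G -> y \in G -> c x = c y -> b x = b y -> x = y.
  by move=> xG yG cxy bxy; apply: finj => //; rewrite (cb x xG).2 (cb y yG).2 cxy bxy.
have [ch bh] := cbP h _ _ hG fh.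
have [c1 b1] : c 1%g = 1 /\ b 1%g = false.
  have [c11 b11] := cbM _ _ (group1 G) (group1 G); rewrite mulg1 in c11 b11.
  have b1 : b 1%g = false by move: b11; case: (b _).
  by split=> //; apply: (mulfI (cn0 _ (group1 G))); rewrite mulr1 [RHS]c11 b1.
pose H := [set x in G | ~~ b x].
have gH : group_set H.
  apply/group_setP; rewrite inE group1 b1; split=> // x y.
  rewrite !inE => /andP[xG /negPf bx] /andP[yG /negPf by_].
  by rewrite groupM //= (cbM x y xG yG).2 bx by_.
pose K := Group gH.
have hK : h \in K by rewrite inE hG bh.
have hn1 : h != 1%g.
  apply/eqP => h1; have := ch; rewrite h1 c1 => /eqP.
  by rewrite -subr_eq0 opprK -mulr2n pnatr_eq0.
have ordh : #[h]%g = 2%N.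
  apply: nt_prime_order => //; rewrite expgS expg1; apply: inj => //; first exact: groupM.
    by rewrite (cbM _ _ hG hG).1 bh ch c1 mulrNN mulr1.
  by rewrite (cbM _ _ hG hG).2 bh b1.
have even_K : ~~ odd #|K| by rewrite -dvdn2 -ordh order_dvdG.
(* On K, [c] is an injective morphism into the multiplicative group of a field, whose finite
   subgroups are cyclic. *)
have cycK : cyclic K.
  apply: (@field_mul_group_cyclic _ K _ c) => [x y|x].
    rewrite !inE => /andP[xG /negPf bx] /andP[yG /negPf by_].
    by rewrite (cbM x y xG yG).1 bx.
  rewrite !inE => /andP[xG /negPf bx]; split=> [cx|->] //.
  by apply: inj; rewrite ?cx ?c1 ?bx ?b1.
have [GK|/subsetPn[s sG sK]] := boolP (G \subset K).
  left; exists #|K|; split=> //.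
  have -> : G = K.
    apply/group_inj/eqP; rewrite finset.eqEsubset GK /=; apply/fintype.subsetP => x.
    by rewrite inE => /andP[].
  exact: cyclic_isog_Zp.
right; exists #|K|; split=> //.
have bs : b s by move: sK; rewrite inE sG /= negbK.
have order2 x : x \in G -> b x -> #[x]%g = 2%N.
  move=> xG bx; apply: nt_prime_order => //; last first.
    by apply: contraL bx => /eqP ->; rewrite b1.
  rewrite expgS expg1; apply: inj => //; first exact: groupM.
    by rewrite (cbM _ _ xG xG).1 bx (cb x xG).1 c1.
  by rewrite (cbM _ _ xG xG).2 bx b1.
have /cyclicP[r defK] := cycK.
have /setIdP[rG br] : r \in H by rewrite -[H]/(gval K) defK cycle_id.
have bsr : b (s * r)%g by rewrite (cbM s r sG rG).2 bs addTb.
(* Equality would make r, hence K, trivial, but K has even order. *)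
have ns_sr : s != (s * r)%g.
  rewrite eq_mulVg1 mulKg.
  apply: contraL even_K => /eqP r1.
  by rewrite defK r1 cycle1 cards1.
have genG : <<[set s; (s * r)%g]%SET>>%g = G.
  apply/eqP; rewrite finset.eqEsubset gen_subG finset.subUset !finset.sub1set sG groupM //=.
  set S := <<_>>%g.
  have sS : s \in S by rewrite mem_gen // finset.set21.
  have rS : r \in S by rewrite -(mulKg s r) groupM ?groupV // mem_gen // finset.set22.
  have KS : K \subset S by rewrite defK cycle_subG.
  apply/fintype.subsetP => x xG; have [bx|bx] := boolP (b x); last first.
    by apply: (fintype.subsetP KS); rewrite inE xG.
  rewrite -(mulKg s x) groupM ?groupV // (fintype.subsetP KS) // inE groupM //=.
  by rewrite (cbM s x sG xG).2 bs bx.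
(* The elements of G outside K form the coset s K. *)
have cardG : #|G| = (2 * #|K|)%N.
  rewrite mul2n -addnn -(cardsID K G); congr addn.
    by apply/eq_card => x; rewrite !inE andbA andbb.
  rewrite -(card_lcoset K s); apply/eq_card => x.
  rewrite mem_lcoset !inE (groupMl _ (groupVr sG)).
  have [xG|xG] := boolP (x \in G); last by rewrite !andbF.
  rewrite /= andbT negbK.
  have [_] := cbM _ _ sG (groupM (groupVr sG) xG).
  by rewrite mulKVg bs addTb => ->.
have := @involutions_gen_dihedral _ s (s * r)%g (order2 _ sG bs)
  (order2 _ (groupM sG rG) bsr) ns_sr.
by rewrite /= genG cardG.
Qed.

Lemma point_group_isometry (R : realType) (U : set R) (g : R[i] -> R[i]) :
  point_group U g -> exists c b, c * Num.conj c = 1 /\ g = plane_isometry c b.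
Proof.
case=> t [[-> _ _]|[-> _ _]]; [exists (cis t), false|exists (cis (2 * t)), true];
  by split=> //; exact: cis_conjM.
Qed.

(** The rotation by pi fixes all angles modulo pi and sends 1 to -1. *)
Lemma point_group_pi (R : realType) (U : set R) :
  U 0 -> at_least_three_angles U -> point_group U (plane_isometry (-1) false).
Proof.
move=> U0 U3; have -> : plane_isometry (-1) false = @rotation R pi.
  by apply/funext => z; rewrite /rotation cis_pi.
apply: point_group_rotation => //; last by rewrite cis_pi; exact: origamiN1.
by move=> a Ua; exists a => //; exists 1; rewrite mul1r addrC addKr.
Qed.

(** * Cyclic and dihedral groups as groups of isometries *)

(** Handles both families at once: the word x^i y^b corresponds to z -> zeta^i z or z -> zeta^i conj
    z, and y x = x^-1 y mirrors conj zeta = zeta^-1. The flag [d] says whether y may occur. *)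
Lemma isog_maps_isometries (R : realType) (gT : finGroupType) (G : {group gT})
    (zeta : R[i]) (n : nat) (d : bool) (x y : gT) :
  n.-primitive_root zeta -> zeta * Num.conj zeta = 1 -> #[x]%g = n ->
  (d -> [/\ (y * y = 1)%g, y \notin <[x]>%g & (y * x = x^-1 * y)%g]) ->
  (forall g, g \in G <-> exists i (b : bool), (b ==> d) /\ g = (x ^+ i * y ^+ b)%g) ->
  isog_maps G [set g | exists i b, (b ==> d) /\ g = plane_isometry (zeta ^+ i) b].
Proof.
move=> zeta_prim zetaJ ox yP GP; have n_gt0 := prim_order_gt0 zeta_prim.
have zeta0 : zeta != 0.
  by apply: contra_eq_neq zetaJ => ->; rewrite mul0r eq_sym oner_neq0.
(* The exponent n - 1 plays the role of -1, so that exponents stay natural numbers. *)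
have conj_zeta : Num.conj zeta = zeta ^+ n.-1.
  by apply: (mulfI zeta0); rewrite zetaJ -exprS prednK // prim_expr_order.
have yxn (i j : nat) : d -> (x ^+ i * y * x ^+ j = x ^+ (i + j * n.-1) * y)%g.
  move=> /yP[_ _ yx]; rewrite expgD -!mulgA; congr mulg.
  have -> : (x ^+ (j * n.-1) = x ^- j)%g.
    rewrite mulnC expgM -expgVn; congr (_ ^+ _)%g.
    by apply: (mulgI x); rewrite mulgV -expgS prednK // -ox expg_order.
  elim: j => [|j IHj]; first by rewrite !expg0 invg1 mul1g mulg1.
  rewrite expgSr mulgA IHj -mulgA yx mulgA -invMg -expgS.
  by rewrite expgSr.
pose w (u : nat * bool) := (x ^+ u.1 * y ^+ u.2)%g.
pose D : set (nat * bool) := [set u | u.2 ==> d].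
apply: (@isog_maps_words gT G _ _ _ D w (fun u => plane_isometry (zeta ^+ u.1) u.2)).
- apply/seteqP; split=> [_ [[i b] Db <-]|g /GP[i [b [db ->]]]] /=.
    by apply/GP; exists i, b.
  by exists (i, b).
- apply/seteqP; split=> [_ [[i b] Db <-]|g [i [b [db ->]]]] /=.
    by exists i, b.
  by exists (i, b).
- move=> [i b] [j c] /= Db Dc.
  have wbb (e : bool) : (x ^+ i * y ^+ e = x ^+ j * y ^+ e)%g <-> (i == j %[mod n]).
    by rewrite -ox -eq_expg_mod_order; split=> [/mulIg/eqP|/eqP ->].
  have Pbb (e : bool) : plane_isometry (zeta ^+ i) e = plane_isometry (zeta ^+ j) e
      <-> (i == j %[mod n]).
    rewrite -(eq_prim_root_expr zeta_prim); split=> [|/eqP -> //].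
    by move=> /plane_isometry_inj -/(_ (expf_neq0 _ zeta0))[-> _].
  have [<-|nbc] := eqVneq b c; first by rewrite /w /= wbb Pbb.
  split; last first.
    move=> /plane_isometry_inj -/(_ (expf_neq0 _ zeta0))[_ bc].
    by rewrite bc eqxx in nbc.
  have dT : d by move: nbc Db Dc; rewrite /D /= -[d]negbK; case: b c (~~ d) => [] [] [].
  have [_ {}yP _] := yP dT.
  rewrite /w /= => ij; case/negP: yP.
  have [xi xj] := (mem_cycle x i, mem_cycle x j).
  case: b c ij nbc {Db Dc} => [] [] //; rewrite expg0 expg1 mulg1 => ij _.
    by rewrite -(groupMl _ xi) ij.
  by rewrite -(groupMl _ xj) -ij.
- move=> [i b] [j c] /= Db Dc.
  (* Moving y past x^j inverts x^j, and y^2 = 1. *)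
  exists (if b then (i + j * n.-1, ~~ c)%N else (i + j, c)%N).
  rewrite plane_isometry_comp /w /D; case: b Db => /= [dd|_]; last first.
    by rewrite expg0 mulg1 mulgA -expgD -exprD.
  have {}dd : d := dd.
  rewrite rmorphXn /= conj_zeta -exprM -exprD (mulnC n.-1); split=> //.
    by rewrite dd implybT.
  rewrite expg1 mulgA yxn // -mulgA; congr mulg.
  have [y2 _ _] := yP dd.
  by case: {Dc} c; rewrite /= ?expg0 ?expg1 ?mulg1.
Qed.

Lemma Zp_isog_maps (R : realType) (gT : finGroupType) (G : {group gT})
    (zeta : R[i]) (n : nat) :
  n.-primitive_root zeta -> zeta * Num.conj zeta = 1 -> (1 < n)%N ->
  (G \isog Zp n)%g ->
  isog_maps G [set g | exists i (b : bool), (b ==> false) /\ g = plane_isometry (zeta ^+ i) b].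
Proof.
move=> zeta_prim zetaJ n_gt1 isoG.
have n_gt0 := ltnW n_gt1.
have cycG : cyclic G.
  by rewrite (isog_cyclic isoG) /= /Zp n_gt1; apply/cyclicP; exists Zp1; exact: Zp_cycle.
have cardG : #|G| = n by rewrite (card_isog isoG) card_Zp.
have /cyclicP[x defG] := cycG.
apply: (isog_maps_isometries (x := x) (y := 1%g) zeta_prim zetaJ) => //.
  by rewrite /order -defG.
move=> g; rewrite defG; split=> [/cycleP[i ->]|[i [b [_ ->]]]].
  by exists i, false; rewrite mulg1.
by rewrite expg1n mulg1 mem_cycle.
Qed.

(** The presentation only bounds the orders of x and y by n and 2; since G = <x><y> has 2 n
    elements, both bounds are attained and <x> meets <y> trivially. *)
Lemma dihedral_isog_maps (R : realType) (gT : finGroupType) (G : {group gT})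
    (zeta : R[i]) (n : nat) :
  n.-primitive_root zeta -> zeta * Num.conj zeta = 1 -> (1 < n)%N ->
  (G \isog dihedral n)%g ->
  isog_maps G [set g | exists i (b : bool), (b ==> true) /\ g = plane_isometry (zeta ^+ i) b].
Proof.
move=> zeta_prim zetaJ n_gt1 isoG; have n_gt0 := ltnW n_gt1.
have cardG : #|G| = (2 * n)%N.
  by rewrite (card_isog isoG) /dihedral /= mul2n card_dihedral.
have : (G \homg Grp (x : y : x ^+ n, y ^+ 2, x ^ y = x^-1))%g.
  by rewrite -Grp_dihedral // -mul2n; exact: isog_hom isoG.
case/existsP=> -[x y] /=; rewrite !xpair_eqE => /and4P[/eqP defG /eqP xn /eqP y2 /eqP xy].
have ox_dvd : (#[x]%g %| n)%N by rewrite order_dvdn xn.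
have oy_dvd : (#[y]%g %| 2)%N by rewrite order_dvdn y2.
have nyx : (<[y]> \subset 'N(<[x]>))%g.
  by rewrite cycle_subG; apply/normP; rewrite -cycleJ xy cycleV.
have GE : (<[x]> * <[y]> = G)%g by rewrite -norm_joinEr.
have [ox oy cap1] : [/\ #[x]%g = n, #[y]%g = 2%N & #|<[x]> :&: <[y]>|%g = 1%N].
  have := mul_cardG <[x]>%G <[y]>%G; rewrite /= GE cardG -!orderE.
  have := cardG_gt0 (<[x]> :&: <[y]>)%G.
  have := dvdn_leq n_gt0 ox_dvd; have := dvdn_leq (isT : (0 < 2)%N) oy_dvd.
  move: #[x]%g #[y]%g #|_| => a b c b2 an c0 abc.
  have c1 : c = 1%N by have := leq_mul an b2; rewrite abc; nia.
  by subst c; split=> //; nia.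
apply: (isog_maps_isometries (x := x) (y := y) zeta_prim zetaJ) => // [_|g].
  split; first by rewrite -(expgS _ 1).
    apply/negP => yx; suff y1 : y = 1%g by move: oy; rewrite y1 order1.
    have capE := @card_le1_trivg _ (<[x]> :&: <[y]>)%G (eq_leq cap1).
    by apply/set1gP; rewrite -capE inE yx cycle_id.
  by rewrite [RHS]conjgC conjVg xy invgK.
rewrite -GE; split=> [/mulsgP[_ _ /cycleP[i ->] /cycleP[j ->] ->]|[i [b [_ ->]]]].
  by exists i, (odd j); split; rewrite ?implybT // -modn2 expg_mod.
by rewrite mem_mulg ?mem_cycle.
Qed.

(** The two coordinate generators are distinct involutions. *)
Lemma klein4_dihedral : (finset.setX (Zp 2) (Zp 2) \isog dihedral 2)%g.
Proof.
pose x : 'Z_2 * 'Z_2 := (Zp1, 1%g); pose y : 'Z_2 * 'Z_2 := (1%g, Zp1).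
have ox : #[x]%g = 2%N by apply: nt_prime_order => //; apply/eqP.
have oy : #[y]%g = 2%N by apply: nt_prime_order => //; apply/eqP.
have := involutions_gen_dihedral ox oy isT.
suff -> : <<[set x; y]%SET>>%g = finset.setX (Zp 2) (Zp 2).
  by rewrite /= cardsX !card_Zp.
apply/eqP; rewrite finset.eqEsubset; apply/andP; split.
  by apply/fintype.subsetP => u _; rewrite inE /Zp /= !inE.
apply/fintype.subsetP => u _.
have -> : u = (x ^+ u.1 * y ^+ u.2)%g.
  by case: u => [[[|[|//]] ?] [[|[|//]] ?]]; apply/eqP.
by rewrite groupM // groupX // mem_gen // (finset.set21, finset.set22).
Qed.

(** * Angle sets with prescribed point group *)

(** In this unit pi is 6 m steps, and the rotation by 2 pi / n for n = 2 m is 6 steps. *)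
Definition grid_step (R : realType) (m : nat) : R := pi / (6 * m)%:R.
Arguments grid_step : clear implicits.

(* {0, 1, 3} + 6Z and {0, 1, 3, 5} + 6Z are invariant under no translation    *)
(* outside 6Z; the second is invariant under negation, while the first is     *)
(* invariant under no reflection.                                             *)
Definition residues (d : bool) : seq int :=
  if d then [:: 0; 1; 3; 5] else [:: 0; 1; 3].

(** As 6 divides 6 m, residues modulo 6 make sense for angles modulo pi. The bound on [x] keeps one
    representative in [0, pi) of each angle, so the set is finite. *)
Definition grid (R : realType) (m : nat) (d : bool) : set R :=
  [set x%:R * grid_step R m |
    x in [set x : nat | (x < 6 * m)%N /\ (x%:Z %% 6)%Z \in residues d]].
Arguments grid : clear implicits.

Lemma finite_grid (R : realType) (m : nat) (d : bool) : finite_set (grid R m d).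
Proof.
apply: finite_image; apply: sub_finite_set (finite_II (6 * m)).
by move=> x [].
Qed.

Lemma grid_step_gt0 (R : realType) (m : nat) : (0 < m)%N -> 0 < grid_step R m.
Proof. by move=> m0; rewrite divr_gt0 ?pi_gt0 // ltr0n muln_gt0. Qed.

Lemma grid_step_inj (R : realType) (m : nat) (k l : int) : (0 < m)%N ->
  k%:~R * grid_step R m = l%:~R * grid_step R m -> k = l.
Proof.
move=> m0 /(mulIf (lt0r_neq0 (grid_step_gt0 R m0)))/eqP.
by rewrite eqr_int => /eqP.
Qed.

Lemma grid_step_pi (R : realType) (m : nat) : (0 < m)%N ->
  (6 * m)%:R * grid_step R m = pi.
Proof.
by move=> m0; rewrite mulrC divfK // pnatr_eq0 -lt0n muln_gt0.
Qed.

Lemma has_angle_grid (R : realType) (m : nat) (d : bool) (t : R) : (0 < m)%N ->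
  has_angle (grid R m d) t <->
  exists2 k : int, t = k%:~R * grid_step R m & (k %% 6)%Z \in residues d.
Proof.
move=> m0; split=> [[_ [x [_ xd] <-] [j tj]]|[k -> kd]].
  exists (x%:Z + j * (6 * m)%:Z).
    rewrite intrD intrM mulrDl -mulrA -[(_ * _)%N%:~R]/((6 * m)%:R) grid_step_pi //.
    by rewrite -tj addrC subrK.
  by rewrite PoszM mulrCA mulrC addrC modzMDl.
pose x := (k %% (6 * m)%:Z)%Z.
have x_ge0 : 0 <= x by rewrite modz_ge0 //; lia.
have kE := divz_eq k (6 * m)%:Z.
have xE : `|x|%N%:Z = x by rewrite gez0_abs.
exists (`|x|%N%:R * grid_step R m); last first.
  exists (k %/ (6 * m)%:Z)%Z.
  rewrite -[`|x|%N%:R]/(`|x|%N%:Z%:~R) xE.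
  move: (grid_step R m) (grid_step_pi R m0) => delta <-.
  rewrite -[(6 * m)%:R]/((6 * m)%:Z%:~R).
  by rewrite mulrA -intrM -mulrBl -intrB {1}kE addrK.
exists `|x|%N => //=; split.
  by rewrite -ltz_nat xE ltz_pmod //; lia.
suff k6 : (k %% 6)%Z = (x %% 6)%Z by rewrite xE -k6.
by rewrite {1}kE PoszM mulrCA mulrC modzMDl.
Qed.

Lemma grid_residue (R : realType) (m : nat) (d : bool) (x : nat) : (0 < m)%N ->
  (x < 6)%N -> (x : int) \in residues d -> grid R m d (x%:R * grid_step R m).
Proof.
move=> m0 x6 xd; exists x => //=; split; first by lia.
by rewrite modz_small //; lia.
Qed.

Lemma grid0 (R : realType) (m : nat) (d : bool) : (0 < m)%N -> grid R m d 0.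
Proof.
by move=> m0; rewrite -(mul0r (grid_step R m)); apply: (@grid_residue R m d 0); case: d.
Qed.

Lemma at_least_three_angles_grid (R : realType) (m : nat) (d : bool) : (0 < m)%N ->
  at_least_three_angles (grid R m d).
Proof.
move=> m0; pose s := grid_step R m; exists (0%:R * s), (1%:R * s), (3%:R * s).
have neq (x y : nat) : (x < y < 6)%N -> ~ eq_mod_pi (x%:R * s) (y%:R * s).
  move=> xy [k]; rewrite -mulrBl -(grid_step_pi R m0) [RHS]mulrA => E.
  have := @grid_step_inj R m (x%:Z - y%:Z) (k * (6 * m)%:Z) m0.
  rewrite intrB intrM => /(_ E) {}E.
  have {E} : x%:Z - y%:Z = 6 * (k * m%:Z) by lia.
  by move: (k * m%:Z) => q; lia.
by split; split; do ?[exact: neq | by apply: grid_residue => //; case: d].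
Qed.

(** The image of 0 shows that t is an integer number k of steps; those of 0, 1 and 3 then force 6 to
    divide k. *)
Lemma grid_rotation (R : realType) (m : nat) (d : bool) (t : R) : (0 < m)%N ->
  (forall a, grid R m d a -> has_angle (grid R m d) (a + t)) <->
  exists j : int, t = (6 * j)%:~R * grid_step R m.
Proof.
move=> m0; split=> [tU|[j ->] a /has_angle_self/(has_angle_grid _ _ m0)[k -> kd]]; last first.
  apply/has_angle_grid => //; exists (k + 6 * j); first by rewrite -mulrDl -intrD.
  by rewrite addrC (mulrC 6 j) modzMDl.
have /(has_angle_grid _ _ m0)[k] := tU _ (grid0 R d m0); rewrite add0r => tk kd.
have shift (x : nat) : (x < 6)%N -> (x : int) \in residues d ->
    ((x%:Z + k) %% 6)%Z \in residues d.
  move=> x6 /(grid_residue R m0 x6)/tU/(has_angle_grid _ _ m0)[l].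
  by rewrite tk -[x%:R]/(x%:Z%:~R) -mulrDl -intrD => /(grid_step_inj m0) ->.
suff k6 : (k %% 6)%Z = 0.
  by exists (k %/ 6)%Z; rewrite tk {1}(divz_eq k 6) k6 addr0 (mulrC 6).
move: kd (shift 1%N isT) (shift 3%N isT).
by case: d {tU shift}; rewrite /residues !inE /= => + /(_ isT) + /(_ isT); lia.
Qed.

(** Here [t] is twice the angle of the axis. Again the images of 0, 1 and 3 decide, and for residues
    0, 1, 3 alone they rule out every k. *)
Lemma grid_reflection (R : realType) (m : nat) (d : bool) (t : R) : (0 < m)%N ->
  (forall a, grid R m d a -> has_angle (grid R m d) (t - a)) <->
  d /\ exists j : int, t = (6 * j)%:~R * grid_step R m.
Proof.
move=> m0; split=> [tU|[dT [j ->]] a /has_angle_self/(has_angle_grid _ _ m0)[k -> kd]]; last first.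
  apply/has_angle_grid => //; exists (6 * j - k); first by rewrite -mulrBl -intrB.
  by move: kd; rewrite dT /residues !inE; lia.
have /(has_angle_grid _ _ m0)[k] := tU _ (grid0 R d m0); rewrite subr0 => tk kd.
have shift (x : nat) : (x < 6)%N -> (x : int) \in residues d ->
    ((k - x%:Z) %% 6)%Z \in residues d.
  move=> x6 /(grid_residue R m0 x6)/tU/(has_angle_grid _ _ m0)[l].
  by rewrite tk -[x%:R]/(x%:Z%:~R) -mulrBl -intrB => /(grid_step_inj m0) ->.
suff [dT k6] : d /\ (k %% 6)%Z = 0.
  by split=> //; exists (k %/ 6)%Z; rewrite tk {1}(divz_eq k 6) k6 addr0 (mulrC 6).
move: kd (shift 1%N isT) (shift 3%N isT).
by case: d {tU shift}; rewrite /residues !inE /= => + /(_ isT) + /(_ isT); lia.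
Qed.

(* -cis (2 s) is [[0, 1]]_{2 s, s}, except that it is -1 for s = 0 mod pi.    *)
Lemma origami_cisN (R : realType) (U : set R) (s : R) :
  U 0 -> at_least_three_angles U -> has_angle U s -> has_angle U (2 * s) ->
  origami U (- cis (2 * s)).
Proof.
move=> U0 U3 Us U2s; have [ss0|/eqP ss0] := eqVneq (sin s) 0.
  have /sin_eq0_mod_pi[k sk] := ss0.
  have -> : cis (2 * s) = 1; last exact: origamiN1.
  rewrite (_ : 2 * s = s + s) 1?mulr_natl // cisD sk.
  by case: (cis_int_pi R k) => ->; rewrite ?mulrNN mulr1.
apply: (origami_inter01 U2s Us).
- by rewrite eq_mod_pi_sin (_ : 2 * s - s = s) //; ring.
- by apply/alineP; exists (-1); rewrite add0r rmorphN rmorph1 mulN1r.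
(* From 1 + cis (2 s) = 2 cos s cis s. *)
apply/alineP; exists (- 2 * cos s).
rewrite (_ : 2 * s = s + s) 1?mulr_natl // cisD.
have sc := cos2Dsin2 s.
apply/eqP; rewrite eq_complex /=; apply/andP; split; apply/eqP.
  lra.
by ring.
Qed.

(** The sign in [origami_cisN] is undone by adding pi, that is 6 m steps. Then s is 3 (j + m) steps
    and 2 s is 6 (j + m) steps, whose residues 0 and 3 belong to both lists. *)
Lemma origami_grid (R : realType) (m : nat) (d : bool) (j : int) : (0 < m)%N ->
  origami (grid R m d) (cis ((6 * j)%:~R * grid_step R m)).
Proof.
move=> m0; pose s := (3 * (j + m%:Z))%:~R * grid_step R m.
have -> : cis ((6 * j)%:~R * grid_step R m) = - cis (2 * s).
  have -> : 2 * s = (6 * j)%:~R * grid_step R m + pi.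
    rewrite -(grid_step_pi R m0) -[(6 * m)%:R]/((6 * m)%:Z%:~R) -mulrDl -intrD.
    rewrite -[2 : R]/(2%:~R) /s mulrA -intrM; congr (_%:~R * _); lia.
  by rewrite cisD cis_pi mulrN1 opprK.
apply: origami_cisN; [exact: grid0|exact: at_least_three_angles_grid| |].
  apply/has_angle_grid => //; exists (3 * (j + m%:Z)) => //.
  by case: d; rewrite /residues !inE; lia.
apply/has_angle_grid => //; exists (6 * (j + m%:Z)).
  rewrite -[2 : R]/(2%:~R) /s mulrA -intrM; congr (_%:~R * _); lia.
by case: d; rewrite /residues !inE; lia.
Qed.

Definition grid_root (R : realType) (m : nat) : R[i] := cis (6%:R * grid_step R m).
Arguments grid_root : clear implicits.

Lemma grid_rootX (R : realType) (m i : nat) :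
  grid_root R m ^+ i = cis ((6 * i%:Z)%:~R * grid_step R m).
Proof. by rewrite -cisMn mulrA -natrM mulnC. Qed.

(** If q is the order, 6 q steps are a multiple of pi, so q is m or 2 m; the power m equals -1,
    which excludes m. *)
Lemma grid_root_prim (R : realType) (m : nat) : (0 < m)%N ->
  (2 * m).-primitive_root (grid_root R m).
Proof.
move=> m0.
have zm : grid_root R m ^+ m = -1.
  by rewrite grid_rootX -[(6 * m%:Z)%:~R]/((6 * m)%:R) grid_step_pi // cis_pi.
have z2m : grid_root R m ^+ (2 * m) = 1 by rewrite mulnC exprM zm sqrrN expr1n.
have n0 : (0 < 2 * m)%N by rewrite muln_gt0.
have [q zq q2m] := prim_order_exists n0 z2m.
suff -> : (2 * m)%N = q by [].
have q0 := prim_order_gt0 zq; have := prim_expr_order zq.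
rewrite grid_rootX => cq.
have /sin_eq0_mod_pi[k] : sin ((6 * q%:Z)%:~R * grid_step R m) = 0.
  by move: cq => /eqP; rewrite eq_complex /= => /andP[_ /eqP].
rewrite -(grid_step_pi R m0) [RHS]mulrA -[(6 * m)%:R]/((6 * m)%:Z%:~R) -intrM.
move=> /(grid_step_inj m0) qk.
have q_neq_m : q <> m.
  move=> qm; have := prim_expr_order zq; rewrite qm zm => /eqP.
  by rewrite eq_sym -subr_eq0 opprK -mulr2n pnatr_eq0.
have := dvdn_leq n0 q2m => q_le.
have qk' : q%:Z = k * m%:Z by lia.
have : 0 < k by nia.
have : k <= 2 by nia.
by move=> k2 k0; have [|] : k = 1 \/ k = 2; nia.
Qed.

Lemma point_group_grid (R : realType) (m : nat) (d : bool) : (0 < m)%N ->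
  point_group (grid R m d) =
  [set g | exists i (b : bool), (b ==> d) /\ g = plane_isometry (grid_root R m ^+ i) b].
Proof.
move=> m0; have [U0 U3] := (grid0 R d m0, at_least_three_angles_grid R d m0).
(* Reducing j modulo 2 m gives a natural exponent, as 12 m steps make a full turn. *)
have rootP (j : int) : exists i, cis ((6 * j)%:~R * grid_step R m) = grid_root R m ^+ i.
  exists `|(j %% (2 * m)%:Z)%Z|%N.
  have x0 : 0 <= (j %% (2 * m)%:Z)%Z by rewrite modz_ge0 //; lia.
  rewrite grid_rootX gez0_abs // {1}(divz_eq j (2 * m)%:Z).
  set q := (j %/ _)%Z; set r := (j %% _)%Z.
  have -> : (6 * (q * (2 * m)%:Z + r))%:~R * grid_step R m =
      (q * 2)%:~R * pi + (6 * r)%:~R * grid_step R m.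
    rewrite -(grid_step_pi R m0) [(q * 2)%:~R * _]mulrA -[(6 * m)%:R]/((6 * m)%:Z%:~R).
    rewrite -intrM -mulrDl -intrD.
    by congr (_%:~R * _); lia.
  rewrite cisD intrM mulrAC -[2%:~R]/(2%:R) mulr_natr mulr2n cisD.
  by case: (cis_int_pi R q) => ->; rewrite ?mulrNN mul1r mul1r.
apply/seteqP; split=> [g [t [[-> tU _]|[-> tU _]]]|g [i [b [bd ->]]]] /=.
- have /(grid_rotation _ _ m0)[j tj] := tU; have [i iE] := rootP j.
  by exists i, false; rewrite -iE -tj.
- have /(grid_reflection _ _ m0)[dT [j tj]] := tU; have [i iE] := rootP j.
  by exists i, true; rewrite -iE -tj.
rewrite grid_rootX; case: b bd => [dT|_].
  (* The axis of z -> zeta^i conj z lies at half the angle of zeta^i, at 3 i steps. *)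
  have -> : (6 * i%:Z)%:~R * grid_step R m = 2 * ((3 * i%:Z)%:~R * grid_step R m).
    by rewrite mulrA -[2 : R]/(2%:~R) -intrM; congr (_%:~R * _); lia.
  apply: point_group_reflection => //.
    apply/grid_reflection => //; split=> //; exists i.
    by rewrite mulrA -[2 : R]/(2%:~R) -intrM; congr (_%:~R * _); lia.
  rewrite mulrA -[2 : R]/(2%:~R) -intrM (_ : 2 * (3 * i%:Z) = 6 * i%:Z); last by lia.
  exact: origami_grid.
apply: point_group_rotation => //; last exact: origami_grid.
by apply/grid_rotation => //; exists i.
Qed.

Theorem theorem10 (R : realType) (gT : finGroupType) (G : {group gT}) :
  (exists U : set R,
     [/\ finite_set U, U 0%R, at_least_three_angles U &
         isog_maps G (point_group U)])
  <->
  [\/ (G \isog finset.setX (Zp 2) (Zp 2))%g,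
      (exists n : nat, [/\ (0 < n)%N, ~~ odd n & (G \isog Zp n)%g]) |
      (exists n : nat, [/\ (0 < n)%N, ~~ odd n & (G \isog dihedral n)%g])].
Proof.
have even_half (n : nat) : (0 < n)%N -> ~~ odd n -> exists2 m, (0 < m)%N & n = (2 * m)%N.
  by move=> n0 n_even; exists n./2; lia.
have dihedral_case n : (0 < n)%N -> ~~ odd n -> (G \isog dihedral n)%g ->
    exists U : set R, [/\ finite_set U, U 0%R, at_least_three_angles U &
      isog_maps G (point_group U)].
  move=> n0 /(even_half n n0)[m m0 ->] isoG; exists (grid R m true).
  split; [exact: finite_grid|exact: grid0|exact: at_least_three_angles_grid|].
  rewrite point_group_grid //.
  apply: dihedral_isog_maps isoG; [exact: grid_root_prim|exact: cis_conjM|lia].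
split=> [[U [_ U0 U3 [f [fP finj fsurj] fM]]]|[isoG|[n [n0 n_even isoG]]|[n [n0 n_even isoG]]]].
- have finjG : {in G &, injective f}.
    by move=> x y xG yG; apply: finj; rewrite inE.
  have fiso : {in G, forall x, exists c b, c * Num.conj c = 1 /\ f x = plane_isometry c b}.
    by move=> x xG; exact: point_group_isometry (fP x xG).
  have fpi : exists2 x, x \in G & f x = plane_isometry (-1) false.
    by have [x xG fx] := fsurj _ (point_group_pi U0 U3); exists x.
  by have [] := finite_plane_group finjG fM fiso fpi; [constructor 2|constructor 3].
- apply: (dihedral_case 2%N) => //; exact: isog_trans isoG klein4_dihedral.
- have [m m0 nE] := even_half n n0 n_even; rewrite nE in isoG.
  exists (grid R m false).
  split; [exact: finite_grid|exact: grid0|exact: at_least_three_angles_grid|].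
  rewrite point_group_grid //.
  apply: Zp_isog_maps isoG; [exact: grid_root_prim|exact: cis_conjM|lia].
- exact: dihedral_case isoG.
Qed.
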